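(* Let $\eta>0$, $\omega>0$, and consider the sequence $\{(y^k,x^k)\}$ generated by the cuPDLPx base iteration (defined in the context) with reflection parameter $\gamma=1$, stepsize $\eta$ and primal weight $\omega$. Consider also the HPR method (defined in the context) with $\mathcal{T}_1=\lambda_A I_m-AA^{*}$ and penalty parameter $\sigma$, generating $\{w^k\}=\{(y^k,z^k,x^k)\}$. If $$\sigma=\frac{\eta}{\omega},\qquad \lambda_A=\frac{1}{\eta^2}\ \ge\ \|A\|^2,$$ and both algorithms are initialized at the same point (i.e. the same $(y^0,x^0)$), then the sequence $\{(x^k,y^k)\}$ generated by cuPDLPx coincides with the sequence $\{(x^k,y^k)\}$ produced by the HPR method.
   Context: Data: $c\in\mathbb{R}^n$, $A\in\mathbb{R}^{m\times n}$ with transpose $A^*$ and spectral norm $\|A\|$; $\mathcal{K}=\{s\in\mathbb{R}^m: l_c\le s\le u_c\}$ with $l_c\in(\mathbb{R}\cup\{-\infty\})^m$, $u_c\in(\mathbb{R}\cup\{\infty\})^m$, and $\mathcal{C}=\{x\in\mathbb{R}^n: l_v\le x\le u_v\}$ with $l_v\in(\mathbb{R}\cup\{-\infty\})^n$, $u_v\in(\mathbb{R}\cup\{\infty\})^n$ (both nonempty). $\Pi_S$ is the Euclidean projection onto $S$, $-\mathcal{K}=\{-s:s\in\mathcal{K}\}$, and $\delta_S^*(v)=\sup_{s\in S}\langle v,s\rangle$. For a self-adjoint positive semidefinite $\mathcal{T}_1$, $\|y\|_{\mathcal{T}_1}^2=\langle y,\mathcal{T}_1y\rangle$. The linear program is $\min_x\{\langle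 c,x\rangle: Ax\in\mathcal{K},\ x\in\mathcal{C}\}$ and its dual is $\min_{y,z}\{\delta_{\mathcal{K}}^*(-y)+\delta_{\mathcal{C}}^*(-z): A^*y+z=c\}$. For $\sigma>0$ the augmented Lagrangian of the dual is $$L_\sigma(y,z;x)=\delta_{\mathcal{K}}^*(-y)+\delta_{\mathcal{C}}^*(-z)+\langle x,A^*y+z-c\rangle+\tfrac{\sigma}{2}\|A^*y+z-c\|^2.$$ HPR method. Input: $\sigma>0$, a self-adjoint positive semidefinite $\mathcal{T}_1:\mathbb{R}^m\to\mathbb{R}^m$ with $\mathcal{T}_1+AA^*$ positive definite, and $w^0=(y^0,z^0,x^0)\in\mathbb{R}^m\times\mathbb{R}^n\times\mathbb{R}^n$. Writing $w=(y,z,x)$, $\bar w=(\bar y,\bar z,\bar x)$, for $k=0,1,\dots$: 1. $\bar z^{k+1}=\arg\min_{z} L_\sigma(y^k,z;x^k)$; 2. $\bar x^{k+1}=x^k+\sigma(A^*y^k+\bar z^{k+1}-c)$; 3. $\bar y^{k+1}=\arg\min_{y}\{L_\sigma(y,\bar z^{k+1};\bar x^{k+1})+\tfrac{\sigma}{2}\|y-y^k\|_{\mathcal{T}_1}^2\}$; 4. $\hat w^{k+1}=2\bar w^{k+1}-w^k$; 5. $w^{k+1}=\frac{1}{k+2}w^0+\frac{k+1}{k+2}\hat w^{k+1}$. cuPDLPx base iteration with reflection parameter $\gamma\in[0,1]$, stepsize $\eta$ and primal weight $\omega$. Starting from $u^0=(y^0,x^0)\in\mathbb{R}^m\times\mathbb{R}^n$,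 with $u^k=(y^k,x^k)$, let $\operatorname{PDHG}(u^k)=(\bar y^{k+1},\bar x^{k+1})$, where $$\bar x^{k+1}=\Pi_{\mathcal{C}}\Big(x^k-\tfrac{\eta}{\omega}(c-A^*y^k)\Big),$$ $$\bar y^{k+1}=y^k-\eta\omega A(2\bar x^{k+1}-x^k)-\eta\omega\,\Pi_{-\mathcal{K}}\Big(\tfrac{1}{\eta\omega}y^k-A(2\bar x^{k+1}-x^k)\Big),$$ and set $$u^{k+1}=\tfrac{k+1}{k+2}\big((1+\gamma)\operatorname{PDHG}(u^k)-\gamma u^k\big)+\tfrac{1}{k+2}u^0.$$
   Formalization: In step 1 of the HPR method the term δ*_K(−y^k), constant in z, is dropped from L_σ before minimizing over z, since it can be +∞ (e.g. K=[0,∞), y^0=−1), making every z a minimizer; when it is finite the arg min is unchanged. *)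

(* Defs.v *)
From HB Require Import structures.
From mathcomp Require Import all_boot all_order all_algebra.
From mathcomp Require Import all_classical all_reals all_analysis.
Set Implicit Arguments.
Unset Strict Implicit.
Unset Printing Implicit Defensive.
Import Order.TTheory GRing.Theory Num.Theory.
Local Open Scope classical_set_scope.
Local Open Scope ring_scope.

(* The library norm `|x| on 'cV[R]_n is the sup norm, hence the Euclidean
   structure below. *)

Section Euclidean.
Context {R : realType}.

Definition dotv {n} (u v : 'cV[R]_n) : R := \sum_i u i ord0 * v i ord0.

Definition enorm {n} (u : 'cV[R]_n) : R := Num.sqrt (dotv u u).

(* The squared (semi)norm <u, T u>. *)
Definition sqnorm_mx {n} (T : 'M[R]_n) (u : 'cV[R]_n) : R := dotv u (T *m u).

(* The set is bounded and contains 0, so the real-valued [sup] is its genuine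
   supremum. *)
Definition spectral_norm {m n} (A : 'M[R]_(m, n)) : R :=
  sup [set enorm (A *m u) | u in [set u | enorm u <= 1]].

Definition box {n} (l u : 'cV[\bar R]_n) : set 'cV[R]_n :=
  [set s : 'cV[R]_n | forall i, (l i ord0 <= (s i ord0)%:E <= u i ord0)%E].

Definition support_fun {n} (S : set 'cV[R]_n) (v : 'cV[R]_n) : \bar R :=
  ereal_sup [set (dotv v s)%:E | s in S].

Definition minimizers {V : zmodType} (D : set V) (f : V -> \bar R) : set V :=
  [set x | D x /\ forall y, D y -> (f x <= f y)%E].

(* A chosen minimizer of f over D; 0 when there is none. *)
Definition argmin {V : zmodType} (D : set V) (f : V -> \bar R) : V :=
  xget 0 (minimizers D f).

Definition proj {n} (S : set 'cV[R]_n) (v : 'cV[R]_n) : 'cV[R]_n :=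
  argmin S (fun s => (enorm (v - s))%:E).

End Euclidean.

Section Algorithms.
Context {R : realType} {m n : nat}.
Variables (A : 'M[R]_(m, n)) (c : 'cV[R]_n).
Variables (K : set 'cV[R]_m) (C : set 'cV[R]_n).

(* All the terms of the augmented Lagrangian except support_fun K (- y). *)
Definition aug_lag_z (sigma : R) (y : 'cV[R]_m) (z x : 'cV[R]_n) : \bar R :=
  (support_fun C (- z)
   + (dotv x (A^T *m y + z - c)
      + sigma / 2 * enorm (A^T *m y + z - c) ^+ 2)%:E)%E.

Definition aug_lag (sigma : R) (y : 'cV[R]_m) (z x : 'cV[R]_n) : \bar R :=
  (support_fun K (- y) + aug_lag_z sigma y z x)%E.

(* The term support_fun K (- y) does not depend on z, but it can be +oo (for
   instance at an arbitrary starting point y^0), which would make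
   aug_lag sigma y z x equal to +oo for every z.  Minimization in z is therefore
   that of aug_lag_z; it is the same thing whenever that term is finite. *)
Lemma argmin_aug_lag_z (sigma : R) (y : 'cV[R]_m) (x : 'cV[R]_n) :
  support_fun K (- y) \is a fin_num ->
  argmin setT (fun z => aug_lag sigma y z x)
  = argmin setT (fun z => aug_lag_z sigma y z x).
Proof.
move=> finK; congr (xget 0 _); apply/seteqP; split => z [_ zmin]; split=> // z' _.
  by move: (zmin z' I); rewrite /aug_lag leeD2lE.
by rewrite /aug_lag leeD2lE // zmin.
Qed.

(* Iterates of the HPR method are triples w = (y, z, x). *)
Definition hpr_bar (T1 : 'M[R]_m) (sigma : R)
    (w : 'cV[R]_m * 'cV[R]_n * 'cV[R]_n) : 'cV[R]_m * 'cV[R]_n * 'cV[R]_n :=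
  let: (y, z, x) := w in
  let zbar := argmin setT (fun z' => aug_lag_z sigma y z' x) in
  let xbar := x + sigma *: (A^T *m y + zbar - c) in
  let ybar := argmin setT (fun y' =>
    (aug_lag sigma y' zbar xbar + (sigma / 2 * sqnorm_mx T1 (y' - y))%:E)%E) in
  (ybar, zbar, xbar).

Fixpoint hpr (T1 : 'M[R]_m) (sigma : R)
    (w0 : 'cV[R]_m * 'cV[R]_n * 'cV[R]_n) (k : nat) :
    'cV[R]_m * 'cV[R]_n * 'cV[R]_n :=
  if k is k'.+1 then
    let w := hpr T1 sigma w0 k' in
    let what := 2%:R *: hpr_bar T1 sigma w - w in
    (1 / k'.+2%:R) *: w0 + (k'.+1%:R / k'.+2%:R) *: what
  else w0.

(* Iterates of cuPDLPx are pairs u = (y, x). *)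
Definition pdhg (eta omega : R) (u : 'cV[R]_m * 'cV[R]_n) :
    'cV[R]_m * 'cV[R]_n :=
  let: (y, x) := u in
  let xbar := proj C (x - (eta / omega) *: (c - A^T *m y)) in
  let v := A *m (2%:R *: xbar - x) in
  let ybar := y - (eta * omega) *: v
    - (eta * omega) *: proj [set - s | s in K] ((1 / (eta * omega)) *: y - v) in
  (ybar, xbar).

Fixpoint cupdlpx (gamma eta omega : R) (u0 : 'cV[R]_m * 'cV[R]_n) (k : nat) :
    'cV[R]_m * 'cV[R]_n :=
  if k is k'.+1 then
    let u := cupdlpx gamma eta omega u0 k' in
    (k'.+1%:R / k'.+2%:R) *: ((1 + gamma) *: pdhg eta omega u - gamma *: u)
    + (1 / k'.+2%:R) *: u0
  else u0.

End Algorithms.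

(* Main.v *)
Require Import Defs.
From mathcomp Require Import all_boot all_order all_algebra.
From mathcomp Require Import all_classical all_reals all_analysis.
From mathcomp Require Import ring lra.
Set Implicit Arguments.
Unset Strict Implicit.
Unset Printing Implicit Defensive.
Import Order.TTheory GRing.Theory Num.Theory.
Local Open Scope classical_set_scope.
Local Open Scope ring_scope.

(** The two methods perform the same step, because a minimization over a dual
    variable whose nonsmooth part is a support function is a projection in
    disguise.

    Let q be the projection of a on a closed convex set S, that is, the point
    of S such that a - q is normal to S at q.  Normality says that q attains
    the supremum defining the support function at t (a - q) for every t >= 0,
    so that q is a subgradient of the support function there.  Hence
    [argmin_support_fun]: a strongly convex quadratic g added to the support
    function of K at - y is minimized exactly at the ystar for which the
    gradient of g is a point of K with normal direction - ystar.

    For the z-step ([argmin_aug_lag_zE]) the gradient at zbar of the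
    smooth part of the augmented Lagrangian is x + sigma (A^* y + zbar - c),
    that is xbar itself, so the optimality condition says that xbar is the projection of
    x + sigma (A^* y - c) on C: the primal step of PDHG with
    eta / omega = sigma.  For the y-step ([argmin_aug_lag_yE]) the choice
    T1 = lambda I - A A^* cancels the Hessian A A^* of the penalty, leaving the
    curvature sigma lambda = 1 / (eta omega), and the linear term becomes
    A (2 xbar - x) because sigma (A^* y + zbar - c) = xbar - x; the minimizer is
    the dual step of PDHG by the Moreau decomposition with respect to - K.

    With reflection parameter 1 the two averagings are the same affine
    combination, so the iterates agree by induction.  The induction closes on
    the pair (y, x) alone because each step recomputes z from y and x. *)

(** * Euclidean inner product *)

Section InnerProduct.
Context {R : realType}.

Lemma dotvC n (u v : 'cV[R]_n) : dotv u v = dotv v u.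
Proof. by apply: eq_bigr => i _; rewrite mulrC. Qed.

Lemma dotvDl n (u v w : 'cV[R]_n) : dotv (u + v) w = dotv u w + dotv v w.
Proof. by rewrite -big_split; apply: eq_bigr => i _; rewrite mxE mulrDl. Qed.

Lemma dotvZl n (a : R) (u v : 'cV[R]_n) : dotv (a *: u) v = a * dotv u v.
Proof. by rewrite /dotv mulr_sumr; apply: eq_bigr => i _; rewrite mxE mulrA. Qed.

Lemma dotvNl n (u v : 'cV[R]_n) : dotv (- u) v = - dotv u v.
Proof. by rewrite -scaleN1r dotvZl mulN1r. Qed.

Lemma dotvDr n (u v w : 'cV[R]_n) : dotv u (v + w) = dotv u v + dotv u w.
Proof. by rewrite dotvC dotvDl !(dotvC u). Qed.

Lemma dotvZr n (a : R) (u v : 'cV[R]_n) : dotv u (a *: v) = a * dotv u v.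
Proof. by rewrite dotvC dotvZl dotvC. Qed.

Lemma dotvNr n (u v : 'cV[R]_n) : dotv u (- v) = - dotv u v.
Proof. by rewrite dotvC dotvNl dotvC. Qed.

Lemma dotv_mulmxr m n (A : 'M[R]_(m, n)) (u : 'cV[R]_m) (v : 'cV[R]_n) :
  dotv u (A *m v) = dotv (A^T *m u) v.
Proof.
have dotvE k (a b : 'cV[R]_k) : dotv a b = (a^T *m b) ord0 ord0.
  by rewrite mxE; apply: eq_bigr => i _; rewrite mxE.
by rewrite !dotvE trmx_mul trmxK mulmxA.
Qed.

Lemma dotv_ge0 n (u : 'cV[R]_n) : 0 <= dotv u u.
Proof. by apply: sumr_ge0 => i _; rewrite -expr2 sqr_ge0. Qed.

Lemma dotv_le0 n (u : 'cV[R]_n) : dotv u u <= 0 -> u = 0.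
Proof.
move=> u_le0; have /eqP : dotv u u = 0 by apply/le_anti; rewrite u_le0 dotv_ge0.
rewrite psumr_eq0 => [/allP uu0|i _]; last by rewrite -expr2 sqr_ge0.
apply/colP => i; have := uu0 i (mem_index_enum _).
by rewrite mulf_eq0 orbb mxE => /eqP.
Qed.

Lemma sqr_enorm n (u : 'cV[R]_n) : enorm u ^+ 2 = dotv u u.
Proof. by rewrite sqr_sqrtr // dotv_ge0. Qed.

Definition dotv_lin := (@dotvDl, @dotvDr, @dotvZl, @dotvZr, @dotvNl, @dotvNr).

End InnerProduct.

(** * Projections and normal directions *)

Section Projection.
Context {R : realType}.

Lemma argmin_unique (V : zmodType) (D : set V) (f : V -> \bar R) (x : V) :
  minimizers D f x -> (forall y, minimizers D f y -> y = x) -> argmin D f = x.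
Proof. by move=> fx uniqx; apply: xget_unique. Qed.

Definition normal_at n (S : set 'cV[R]_n) (q d : 'cV[R]_n) : Prop :=
  S q /\ forall s, S s -> dotv d (s - q) <= 0.

(** Expanding |a - s|^2 around q, the cross term has a sign by normality, so
    |a - s|^2 >= |a - q|^2 + |s - q|^2. *)
Lemma normal_at_proj n (S : set 'cV[R]_n) (a q : 'cV[R]_n) :
  normal_at S q (a - q) -> Defs.proj S a = q.
Proof.
move=> [Sq qP].
have pyth s : S s -> dotv (a - q) (a - q) + dotv (s - q) (s - q)
    <= dotv (a - s) (a - s).
  move=> Ss; have := qP s Ss.
  have -> : a - s = (a - q) - (s - q) by rewrite opprB addrA subrK.
  move: (a - q) (s - q) => d e; rewrite !dotv_lin (dotvC e d); lra.
apply: argmin_unique.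
  split=> // s Ss; rewrite lee_fin ler_sqrt ?dotv_ge0 //.
  by have := pyth s Ss; have := dotv_ge0 (s - q); lra.
move=> s [Ss /(_ q Sq)]; rewrite lee_fin ler_sqrt ?dotv_ge0 // => le_sq.
by apply/eqP; rewrite -subr_eq0; apply/eqP/dotv_le0; have := pyth s Ss; lra.
Qed.

Lemma normal_atZ n (S : set 'cV[R]_n) (q d : 'cV[R]_n) (t : R) :
  0 <= t -> normal_at S q d -> normal_at S q (t *: d).
Proof.
move=> t0 [Sq dP]; split=> // s Ss.
by rewrite dotvZl mulr_ge0_le0 // dP.
Qed.

Lemma normal_at_opp n (S : set 'cV[R]_n) (q d : 'cV[R]_n) :
  normal_at S q d -> normal_at [set - s | s in S] (- q) (- d).
Proof.
move=> [Sq dP]; split; first by exists q.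
by move=> _ [s Ss <-]; rewrite -opprD dotvNl dotvNr opprK dP.
Qed.

(** The constraints of a box are independent, so the normal condition can be
    solved one coordinate at a time, by clamping. *)
Lemma clamp_normal (l u : \bar R) (s0 a : R) :
  (l <= s0%:E <= u)%E ->
  exists2 q : R, (l <= q%:E <= u)%E &
    forall s : R, (l <= s%:E <= u)%E -> (a - q) * (s - q) <= 0.
Proof.
move=> /andP[ls0 s0u].
have [al|la] := ltP a%:E l.
  case: l ls0 al => [l| |] //= ls0 al; exists l.
    by rewrite lexx (le_trans ls0).
  move: al; rewrite lte_fin => al s; rewrite lee_fin => /andP[ls _].
  by rewrite mulr_le0_ge0 ?subr_le0 ?subr_ge0 // ltW.
have [ua|au] := ltP u a%:E.
  case: u s0u ua => [u| |] //= s0u ua; exists u.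
    by rewrite lexx (le_trans ls0).
  move: ua; rewrite lte_fin => ua s; rewrite !lee_fin => /andP[_ su].
  by rewrite mulr_ge0_le0 ?subr_le0 ?subr_ge0 // ltW.
by exists a => [|s _]; rewrite ?la ?subrr ?mul0r.
Qed.

Lemma box_normal n (l u : 'cV[\bar R]_n) (a : 'cV[R]_n) :
  box l u !=set0 -> exists q, normal_at (box l u) q (a - q).
Proof.
move=> [s0 s0P].
have /choice[q qP] i : exists q : R, (l i ord0 <= q%:E <= u i ord0)%E /\
    forall s : R, (l i ord0 <= s%:E <= u i ord0)%E ->
      (a i ord0 - q) * (s - q) <= 0.
  by have [q] := @clamp_normal _ _ _ (a i ord0) (s0P i); exists q.
exists (\col_i q i); split=> [i|s Ss]; first by rewrite mxE; have [] := qP i.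
by apply: sumr_le0 => i _; rewrite !mxE; have [_] := qP i; apply; apply: Ss.
Qed.

Lemma box_proj_normal n (l u : 'cV[\bar R]_n) (a : 'cV[R]_n) :
  let p := Defs.proj (box l u) a in
  box l u !=set0 -> normal_at (box l u) p (a - p).
Proof. by move=> p /(@box_normal _ _ _ a)[q qP]; rewrite /p (normal_at_proj qP). Qed.

Lemma box_proj_opp_normal n (l u : 'cV[\bar R]_n) (a : 'cV[R]_n) :
  let q := Defs.proj [set - s | s in box l u] a in
  box l u !=set0 -> normal_at (box l u) (- q) (- (a - q)).
Proof.
move=> q /(@box_normal _ _ _ (- a))[p pP].
have qE : q = - p.
  by apply: normal_at_proj; have := normal_at_opp pP; rewrite opprB !opprK addrC.
by rewrite qE !opprK opprD.
Qed.

End Projection.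

(** * Minimization of a support function plus a quadratic *)

Section SupportFunction.
Context {R : realType}.

Lemma support_fun_ge n (S : set 'cV[R]_n) (v q : 'cV[R]_n) :
  S q -> ((dotv v q)%:E <= support_fun S v)%E.
Proof. by move=> Sq; apply: ereal_sup_ubound; exists q. Qed.

Lemma support_fun_normal n (S : set 'cV[R]_n) (q d : 'cV[R]_n) :
  normal_at S q d -> support_fun S d = (dotv d q)%:E.
Proof.
move=> [Sq dP]; apply/le_anti/andP; split; last exact: support_fun_ge.
apply: ge_ereal_sup => _ [s Ss <-]; rewrite lee_fin.
by have := dP s Ss; rewrite dotvDr dotvNr subr_le0.
Qed.

(** Fermat's rule.  The expansion of g around ystar makes it a quadratic with
    Hessian 2 t I whose gradient at ystar is q; since q is a subgradient of the
    support function at - ystar, the first-order terms cancel and the objective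
    exceeds its value at ystar by at least t |y - ystar|^2. *)
Lemma argmin_support_fun n (S : set 'cV[R]_n) (f : 'cV[R]_n -> \bar R)
    (g : 'cV[R]_n -> R) (t : R) (q ystar : 'cV[R]_n) :
  0 < t -> normal_at S q (- ystar) ->
  (forall y, f y = support_fun S (- y) + (g y)%:E)%E ->
  (forall y, g y = g ystar + dotv (y - ystar) q
                   + t * dotv (y - ystar) (y - ystar)) ->
  argmin setT f = ystar.
Proof.
move=> t0 qP fE gE.
have fstarE : f ystar = (- dotv ystar q + g ystar)%:E.
  by rewrite fE (support_fun_normal qP) dotvNl.
have growth y :
    ((- dotv ystar q + g ystar + t * dotv (y - ystar) (y - ystar))%:E <= f y)%E.
  have [Sq _] := qP.
  rewrite fE; apply: le_trans (leeD2r _ (support_fun_ge (- y) Sq)).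
  rewrite -EFinD lee_fin (gE y); move: (dotv (y - ystar) (y - ystar)) => dd.
  by rewrite !dotv_lin; lra.
apply: argmin_unique.
  split=> // y _; rewrite fstarE; apply: le_trans (growth y).
  by rewrite lee_fin lerDl mulr_ge0 ?dotv_ge0 // ltW.
move=> y [_ /(_ ystar I)]; rewrite fstarE => /(le_trans (growth y)).
rewrite lee_fin gerDl pmulr_rle0 // => /dotv_le0 /eqP.
by rewrite subr_eq0 => /eqP.
Qed.

End SupportFunction.

(** * The two steps coincide *)

Section Steps.
Context {R : realType} {m n : nat}.
Variables (A : 'M[R]_(m, n)) (c : 'cV[R]_n).

(** The multiplier after the z-step, x + sigma (A^* y + z - c), is the gradient
    in z of the smooth part, and it equals p at the proposed minimizer; there
    - z is a positive multiple of v - p, normal to C at p. *)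
Lemma argmin_aug_lag_zE (C : set 'cV[R]_n) (sigma : R) (y : 'cV[R]_m)
    (x p : 'cV[R]_n) :
  let v := x - sigma *: (c - A^T *m y) in
  0 < sigma -> normal_at C p (v - p) ->
  argmin setT (fun z => aug_lag_z A c C sigma y z x) = sigma^-1 *: (p - v).
Proof.
move=> v s0 pP; set zs := sigma^-1 *: (p - v).
apply: (@argmin_support_fun _ _ C _
  (fun z => dotv x (A^T *m y + z - c)
            + sigma / 2 * enorm (A^T *m y + z - c) ^+ 2) (sigma / 2) p) => //.
- by rewrite divr_gt0.
- by rewrite -scalerN opprB; apply: normal_atZ => //; rewrite invr_ge0 ltW.
move=> z; rewrite !sqr_enorm.
(* p is the gradient: the residual at zs is (p - x) / sigma *)
set r := A^T *m y + zs - c; set d := z - zs.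
have -> : A^T *m y + z - c = r + d.
  by apply/colP => i; rewrite !mxE; ring.
have -> : p = x + sigma *: r.
  have s_neq0 := lt0r_neq0 s0.
  by apply/colP => i; rewrite /r /zs /v !mxE; field.
by move: r d => r d; rewrite !dotv_lin (dotvC d r) (dotvC x d); field.
Qed.

(** For the proximal matrix lambda I - A A^* the quadratic terms in A A^* cancel:
    up to a constant, the objective is support_fun K (- y) + <v, y>
    + sigma lambda / 2 |y - yk|^2, whose smooth part has gradient q at ystar.
    Finiteness of the support function of C at - z keeps the z-part of the
    Lagrangian, constant in y, from absorbing the objective. *)
Lemma argmin_aug_lag_yE (K : set 'cV[R]_m) (C : set 'cV[R]_n)
    (sigma lambda : R) (yk : 'cV[R]_m) (z xbar : 'cV[R]_n) (q : 'cV[R]_m) :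
  let v := A *m (xbar + sigma *: (A^T *m yk + z - c)) in
  let ystar := yk - (sigma * lambda)^-1 *: (v - q) in
  0 < sigma -> 0 < lambda -> support_fun C (- z) \is a fin_num ->
  normal_at K q (- ystar) ->
  argmin setT (fun y =>
    (aug_lag A c K C sigma y z xbar
     + (sigma / 2 * sqnorm_mx (lambda%:M - A *m A^T) (y - yk))%:E)%E) = ystar.
Proof.
move=> v ystar s0 l0 finC qP.
apply: (@argmin_support_fun _ _ K _ (fun y => fine (support_fun C (- z))
   + (dotv xbar (A^T *m y + z - c) + sigma / 2 * enorm (A^T *m y + z - c) ^+ 2)
   + sigma / 2 * sqnorm_mx (lambda%:M - A *m A^T) (y - yk))
   (sigma * lambda / 2) q) => //.
- by rewrite divr_gt0 // mulr_gt0.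
- by move=> y; rewrite /aug_lag /aug_lag_z -(fineK finC) -!EFinD -addeA.
move=> y.
set rk := A^T *m yk + z - c; set d := y - ystar; set e := ystar - yk.
(* optimality of ystar, solved for the gradient *)
have qE : q = v + (sigma * lambda) *: e.
  have sl_neq0 : sigma * lambda != 0 by rewrite mulf_neq0 // lt0r_neq0.
  rewrite /e /ystar addrAC subrr add0r scalerN scalerA divff // scale1r.
  by rewrite opprB addrC subrK.
have resE t : A^T *m (yk + t) + z - c = rk + A^T *m t.
  by rewrite mulmxDr /rk; apply/colP => i; rewrite !mxE; ring.
have -> : y = yk + (e + d) by rewrite addrA [yk + e]addrC subrK addrC subrK.
have -> : ystar = yk + e by rewrite addrC subrK.
rewrite !resE ![yk + _]addrC !addrK qE /v -/rk !sqr_enorm /sqnorm_mx.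
move: rk e d {resE qE} => r e d.
rewrite !mulmxBl !mul_scalar_mx -!mulmxA !mulmxDr -scalemxAr.
rewrite !dotv_lin !(dotv_mulmxr A).
rewrite (dotvC d e) (dotvC (A^T *m e) r) (dotvC (A^T *m d) r).
rewrite (dotvC (A^T *m d) xbar) (dotvC (A^T *m d) (A^T *m e)).
by field.
Qed.

(** One step of PDHG is one step of HPR with z forgotten.  The z-step returns
    (p - v) / sigma with p the projection of v, so that the update of x gives
    exactly p; the smooth part of the y-step then has gradient A (2 p - x) at y, and its
    optimality condition is met at the dual step of PDHG by minus the projection
    on - K, which lies in K. *)
Lemma pdhg_hpr_bar (lc uc : 'cV[\bar R]_m) (lv uv : 'cV[\bar R]_n)
    (eta omega : R) (y : 'cV[R]_m) (z x : 'cV[R]_n) :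
  let K := box lc uc in
  let C := box lv uv in
  let wbar := hpr_bar A c K C ((1 / eta ^+ 2)%:M - A *m A^T) (eta / omega)
                (y, z, x) in
  K !=set0 -> C !=set0 -> 0 < eta -> 0 < omega ->
  pdhg A c K C eta omega (y, x) = (wbar.1.1, wbar.2).
Proof.
move=> K C wbar K0 C0 eta0 omega0.
rewrite /wbar /hpr_bar /pdhg.
set sigma := eta / omega; set v := x - _ *: _.
set p := Defs.proj C v.
have sigma0 : 0 < sigma by rewrite divr_gt0.
have sigma_neq0 := lt0r_neq0 sigma0.
have eta_neq0 := lt0r_neq0 eta0.
have omega_neq0 := lt0r_neq0 omega0.
have pP : normal_at C p (v - p) by apply: box_proj_normal.
rewrite (argmin_aug_lag_zE sigma0 pP).
have finC : support_fun C (- (sigma^-1 *: (p - v))) \is a fin_num.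
  rewrite -scalerN opprB (@support_fun_normal _ _ _ p) //.
  by apply: normal_atZ => //; rewrite invr_ge0 ltW.
have xbarE : x + sigma *: (A^T *m y + sigma^-1 *: (p - v) - c) = p.
  by apply/colP => i; rewrite /v !mxE; field.
have resE : sigma *: (A^T *m y + sigma^-1 *: (p - v) - c) = p - x.
  by rewrite -[X in _ = X - x]xbarE [RHS]addrC addKr.
rewrite xbarE; congr pair; apply/esym.
set a := A *m (_ - x); set b := _ *: y - a.
have := @box_proj_opp_normal _ _ lc uc b K0.
rewrite -/K; set q := Defs.proj _ b => qP.
have lambda0 : 0 < 1 / eta ^+ 2 by rewrite divr_gt0 // exprn_gt0.
have tauE : (sigma * (1 / eta ^+ 2))^-1 = eta * omega.
  by rewrite /sigma; field; rewrite eta_neq0 omega_neq0.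
have aE : a = A *m (p + sigma *: (A^T *m y + sigma^-1 *: (p - v) - c)).
  by rewrite /a resE addrA scaler_nat.
rewrite (@argmin_aug_lag_yE K C sigma _ y _ p (- q)) //.
  by rewrite -aE tauE opprK scalerDr opprD addrA.
(* Moreau decomposition: the dual step is a multiple of the residual b - q *)
rewrite -aE tauE opprK.
suff -> : y - (eta * omega) *: (a + q) = (eta * omega) *: (b - q).
  by rewrite -scalerN; apply: normal_atZ => //; rewrite ltW // mulr_gt0.
rewrite /b -addrA -opprD scalerBr scalerA mul1r divff ?scale1r //.
by rewrite mulf_neq0.
Qed.

End Steps.

Unset Implicit Arguments.

Theorem proposition3p1 (R : realType) (m n : nat)
    (A : 'M[R]_(m, n)) (c : 'cV[R]_n)
    (lc uc : 'cV[\bar R]_m) (lv uv : 'cV[\bar R]_n)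
    (hlc : forall i, lc i ord0 != +oo%E) (huc : forall i, uc i ord0 != -oo%E)
    (hlv : forall j, lv j ord0 != +oo%E) (huv : forall j, uv j ord0 != -oo%E)
    (hK : box lc uc !=set0) (hC : box lv uv !=set0)
    (eta omega sigma lambdaA : R)
    (heta : 0 < eta) (homega : 0 < omega)
    (hsigma : sigma = eta / omega)
    (hlambda : lambdaA = 1 / eta ^+ 2)
    (hA : spectral_norm A ^+ 2 <= lambdaA)
    (y0 : 'cV[R]_m) (z0 x0 : 'cV[R]_n) :
  let K := box lc uc in
  let C := box lv uv in
  let w := hpr A c K C (lambdaA%:M - A *m A^T) sigma (y0, z0, x0) in
  let u := cupdlpx A c K C 1 eta omega (y0, x0) in
  forall k : nat, (u k).1 = (w k).1.1 /\ (u k).2 = (w k).2.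
Proof.
move=> K C w u; elim=> [//|k IH].
have uS : u k.+1 = (k.+1%:R / k.+2%:R) *:
    ((1 + 1) *: pdhg A c K C eta omega (u k) - 1 *: u k)
    + (1 / k.+2%:R) *: (y0, x0) by [].
have wS : w k.+1 = (1 / k.+2%:R) *: (y0, z0, x0) + (k.+1%:R / k.+2%:R) *:
    (2%:R *: hpr_bar A c K C (lambdaA%:M - A *m A^T) sigma (w k) - w k) by [].
rewrite {}uS {}wS; case: (w k) IH => [[y z] x] IH.
have -> : u k = (y, x) by case: (u k) IH => yk xk [/= -> ->].
have := pdhg_hpr_bar A c y z x hK hC heta homega.
rewrite -hsigma -hlambda -/K -/C => ->.
case: (hpr_bar _ _ _ _ _ _ _) => [[ybar zbar] xbar].
by split; rewrite /= scale1r [LHS]addrC.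
Qed.
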